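(* Any valuation semiring is divided.
   Context: A semiring is a set $S$ with operations $+,\cdot$ and elements $0\neq 1$ such that $(S,+,0)$ is a commutative monoid, $(S,\cdot,1)$ is a monoid, multiplication distributes over addition on both sides, and $a\cdot 0=0\cdot a=0$ for all $a\in S$. All semirings are assumed commutative (multiplication is commutative). An ideal of $S$ is a nonempty subset $\mathfrak{a}$ closed under addition with $sx\in\mathfrak{a}$ for all $s\in S$, $x\in\mathfrak{a}$; it is proper if $\mathfrak{a}\neq S$; $(x)$ is the principal ideal generated by $x$. A semidomain is a semiring in which $xy=xz$ and $x\neq 0$ imply $y=z$. A valuation semiring is a semidomain whose ideals are totally ordered by inclusion. A proper ideal $\mathfrak{p}$ is prime if $ab\in\mathfrak{p}$ implies $a\in\mathfrak{p}$ or $b\in\mathfrak{p}$. A prime ideal $\mathfrak{p}$ is divided if $\mathfrak{p}\subsetneq(x)$ for every $x\in S\setminus\mathfrak{p}$. A semiring $S$ is divided if each prime ideal of $S$ is divided. *)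

(* Defs.v *)
From mathcomp Require Import all_boot all_algebra.
From mathcomp Require Import classical_sets.

Set Implicit Arguments.
Unset Strict Implicit.
Unset Printing Implicit Defensive.

Import GRing.Theory.
Local Open Scope classical_set_scope.
Local Open Scope ring_scope.

(* A comNzSemiRingType is exactly a commutative semiring with 1 != 0. Its
   Choice component is no restriction classically: boolp.v equips every type
   with a choice operator. Ideals are arbitrary (Prop-valued) subsets. *)

Section Semirings.
Variable S : comNzSemiRingType.

Definition is_ideal (a : set S) : Prop :=
  [/\ a !=set0,
      forall x y : S, a x -> a y -> a (x + y)
    & forall s x : S, a x -> a (s * x)].

(* (x): the intersection of all the ideals containing x *)
Definition principal_ideal (x : S) : set S := smallest is_ideal [set x].

Definition proper_ideal (a : set S) : Prop := is_ideal a /\ a <> setT.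

Definition prime_ideal (p : set S) : Prop :=
  proper_ideal p /\ forall a b : S, p (a * b) -> p a \/ p b.

(* `<` is strict inclusion *)
Definition divided_ideal (p : set S) : Prop :=
  prime_ideal p /\ forall x : S, ~ p x -> p `<` principal_ideal x.

End Semirings.

Definition semidomain (S : comNzSemiRingType) : Prop :=
  forall x y z : S, x * y = x * z -> x <> 0 -> y = z.

Definition valuation_semiring (S : comNzSemiRingType) : Prop :=
  semidomain S /\
  forall a b : set S, is_ideal a -> is_ideal b -> a `<=` b \/ b `<=` a.

Definition divided_semiring (S : comNzSemiRingType) : Prop :=
  forall p : set S, prime_ideal p -> divided_ideal p.

(* Main.v *)
Require Import Defs.
From mathcomp Require Import all_boot all_algebra.
From mathcomp Require Import classical_sets.

Local Open Scope classical_set_scope.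

(** For x outside a prime p, (x) is not contained in p, since x lies in (x). As p and (x) are
    comparable, p is contained in (x), and strictly. *)

Lemma mem_principal_ideal (S : comNzSemiRingType) (x : S) :
  principal_ideal x x.
Proof. by move=> a [_ xa]; exact: xa. Qed.

(** Closure passes to an intersection of ideals; x itself keeps it nonempty. *)
Lemma principal_ideal_is_ideal (S : comNzSemiRingType) (x : S) :
  is_ideal (principal_ideal x).
Proof.
split; first by exists x; exact: mem_principal_ideal.
- move=> y z xy xz a aP; have [[_ aD _] _] := aP.
  by apply: aD; [exact: xy | exact: xz].
- move=> s y xy a aP; have [[_ _ aM] _] := aP.
  by apply: aM; exact: xy.
Qed.

Theorem proposition2p4 (S : comNzSemiRingType) :
  valuation_semiring S -> divided_semiring S.
Proof.
move=> [_ ideals_total] p p_prime; split=> // x npx.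
have [[p_ideal _] _] := p_prime.
(* Serves twice: as the strictness of the inclusion, and to exclude one case of [ideals_total]. *)
have nxp : ~ principal_ideal x `<=` p.
  by move=> xp; apply: npx; apply: xp; exact: mem_principal_ideal.
split=> //.
by have [|/nxp] := ideals_total _ _ p_ideal (principal_ideal_is_ideal S x).
Qed.
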